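(* There are no continuous $\mathbb{C}$-equivariant maps $\xi:\mathrm{Free}(C^\infty(\mathbb{C},\mathbb{C}))\to C^\infty(\mathbb{C},\mathbb{C})$ such that $\bar\partial(\xi(f))=f$ for all $f\in\mathrm{Free}(C^\infty(\mathbb{C},\mathbb{C}))$.
   Context: $C^\infty(\mathbb{C},\mathbb{C})$ is the space of smooth (in the real sense) complex-valued functions on $\mathbb{C}$, with its usual Fréchet topology of locally uniform convergence of all partial derivatives. $\bar\partial=\frac12\left(\frac{\partial}{\partial x}+\mathrm{i}\frac{\partial}{\partial y}\right)$. The additive group $\mathbb{C}$ acts by argument shifts $(w\cdot f)(z)=f(z+w)$, and $\mathrm{Free}(C^\infty(\mathbb{C},\mathbb{C}))$ is the set of elements with trivial stabilizer, with the subspace topology. *)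

(* Defs.v *)
From HB Require Import structures.
From mathcomp Require Import all_boot all_order all_algebra.
From mathcomp Require Import all_classical all_reals all_analysis.
From mathcomp Require Import complex.
Set Implicit Arguments.
Unset Strict Implicit.
Unset Printing Implicit Defensive.
Import Order.TTheory GRing.Theory Num.Theory.
Import numFieldNormedType.Exports.
Local Open Scope classical_set_scope.
Local Open Scope ring_scope.

(* [Rcomplex R] is [R[i]] seen as a normed space over the field [R]: a
   directional derivative ['D_v f] of [f : Rcomplex R -> Rcomplex R] is thus
   taken along a real parameter. *)
Section RcomplexNormedModule.
Variable R : rcfType.

HB.instance Definition _ := isPointed.Build (Rcomplex R) 0.
HB.instance Definition _ :=
  PseudoMetric.copy (Rcomplex R) (pseudoMetric_normed (Rcomplex R)).
HB.instance Definition _ :=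
  NormedZmod_PseudoMetric_eq.Build R (Rcomplex R) erefl.

Lemma Rcomplex_normrZ (l : R) (x : Rcomplex R) : `|l *: x| = `|l| * `|x|.
Proof.
case: x => a b; rewrite /Num.norm /= /Normc.normc.
by rewrite !exprMn -mulrDr Num.Theory.sqrtrM ?sqr_ge0// sqrtr_sqr.
Qed.

HB.instance Definition _ :=
  PseudoMetricNormedZmod_Lmodule_isNormedModule.Build R (Rcomplex R)
    Rcomplex_normrZ.

End RcomplexNormedModule.

Section Smooth.
Variable R : realType.
Local Notation C := (Rcomplex R).
Implicit Types (f : C -> C) (s : seq bool) (w z : C).

Definition imagunit : C := Complex 0 1.

(* [false] stands for the x-axis and [true] for the y-axis. *)
Definition axis (b : bool) : C := if b then imagunit else 1.

Definition partial (b : bool) f : C -> C := fun z => 'D_(axis b) f z.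

Definition partials s f : C -> C := foldr partial f s.

Definition smooth f : Prop := forall s,
  continuous (partials s f) /\
  forall b z, derivable (partials s f) z (axis b).

Definition dbar f : C -> C :=
  fun z => 2^-1 * (partial false f z + imagunit * partial true f z).

Lemma partials_comp_shift s f w :
  partials s (fun z => f (z + w)) = (fun z => partials s f (z + w)).
Proof.
elim: s => [//|b s IHs] /=; rewrite IHs; apply/funext => z.
rewrite /partial /derive.
under [X in lim (X @ _)]eq_fun do rewrite /= -addrA.
by [].
Qed.

Lemma smooth_comp_shift f w : smooth f -> smooth (fun z => f (z + w)).
Proof.
move=> sf s; rewrite partials_comp_shift; have [cf df] := sf s; split.
  have cw : continuous (fun z : C => z + w).
    move=> z; apply: (@cvgD R C _ (nbhs z) _ id (cst w)).
      exact: cvg_id.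
    exact: cvg_cst.
  by move=> z; apply: (@continuous_comp _ _ _ (+%R^~ w)); [exact: cw|exact: cf].
move=> b z; have := df b (z + w); rewrite /derivable.
by under eq_fun do rewrite /= addrA.
Qed.

Definition Cinfty : Type := [set f | smooth f].

HB.instance Definition _ := Choice.on Cinfty.

Definition Cinfty_fun (f : Cinfty) : C -> C := \val f.

End Smooth.

Coercion Cinfty_fun : Cinfty >-> Funclass.

Section CinftySpace.
Variable R : realType.
Local Notation C := (Rcomplex R).
Implicit Types (f : Cinfty R) (w : C).

Definition jet f : {ptws seq bool -> {family compact, C -> C}} :=
  fun s => partials s f.

(* The coarsest topology for which every iterated partial derivative is
   continuous into the space of functions with uniform convergence on
   compact sets. *)
HB.instance Definition _ :=
  Topological.copy (Cinfty R) (initial_topology jet).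

Definition translate w f : Cinfty R :=
  exist _ (fun z => f (z + w)) (mem_set (smooth_comp_shift w (set_valP f))).

Definition stabilizer f : set C := [set w | translate w f = f].

Definition Free : set (Cinfty R) := [set f | stabilizer f = [set 0]].

Lemma translateC v w f : translate v (translate w f) = translate w (translate v f).
Proof. by apply/val_inj/funext => z; rewrite /= /Cinfty_fun /= addrAC. Qed.

Lemma translate_inj w : injective (translate w).
Proof.
move=> f g /(congr1 val) fg; apply/val_inj/funext => z.
by have := congr1 (@^~ (z - w)) fg; rewrite /= /Cinfty_fun subrK.
Qed.

Lemma Free_translate w f : Free f -> Free (translate w f).
Proof.
move=> Ff; rewrite /Free /= -[RHS]Ff; apply/seteqP; split => v /=.
  by rewrite /stabilizer /= translateC => /translate_inj.
by rewrite /stabilizer /= translateC => ->.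
Qed.

Definition translate_free w (f : Free) : Free :=
  exist _ (translate w (\val f)) (mem_set (Free_translate w (set_valP f))).

End CinftySpace.

Arguments Free R : clear implicits.

(* Main.v *)
Require Import Defs.
From mathcomp Require Import all_boot all_order all_algebra.
From mathcomp Require Import all_classical all_reals all_analysis.
From mathcomp Require Import complex.
From mathcomp Require Import ring lra.
Set Implicit Arguments.
Unset Strict Implicit.
Unset Printing Implicit Defensive.
Import Order.TTheory GRing.Theory Num.Theory.
Import numFieldNormedType.Exports.
Local Open Scope classical_set_scope.
Local Open Scope ring_scope.

(** The obstruction is the divergence theorem, applied on a compact part of the
    free locus.

    Take [f z = 5 + cos x + cos (sqrt 2 x) + cos y + cos (sqrt 2 y)] and let the
    four phases vary.  The waves so obtained form a torus, which is compact,
    which is stable under translation (a shift of the argument only changes the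
    phases, [translate_free_wave]), and which consists of functions with trivial
    stabilizer because [sqrt 2] is irrational ([smooth_wave_Free]).  A continuous
    equivariant [xi] maps this torus to a compact subset of the smooth functions.
    A partial derivative of [xi f] at [z] is the same partial derivative at [0]
    of [xi (translate_free z f)], so every partial derivative of [g := xi f] is
    bounded on the whole plane ([bounded_partials_of_compact_orbit]).

    But [dbar g = f >= 1] says that the plane vector field [(Re g, - Im g)] has
    divergence at least [2].  Its flux out of a large square grows like the area,
    while a bounded field has flux at most of the order of the perimeter
    ([dbar_primitive_unbounded]).  Integrals are replaced by Riemann sums along
    columns: the bound on the second vertical derivative of [g] makes the
    discretization error uniform in the plane. *)

(** * Topology and directional derivatives *)

Lemma continuous_into_ptws (S : eqType) (X T : topologicalType)
    (f : X -> {ptws S -> T}) :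
  (forall s, continuous (fun x => f x s)) -> continuous f.
Proof.
move=> fc x; apply/(@cvg_sup _ S
  (fun s =>
    Topological.class (initial_topology (fun g : {ptws S -> T} => g s)))
  (f @ x) (f x) _) => s.
exact: (@continuous_comp_initial _ X T (fun g : {ptws S -> T} => g s) f
  (fc s) x).
Qed.

Section DirectionalDerivative.
Variable R : realType.

(** Only the scalar multiplication and subtraction of the difference quotient
    are seen, so that [L] can be a coordinate of [Rcomplex R] or the embedding of
    [R] without any linear structure being declared on it. *)
Lemma is_derive_linear (V W W' : normedModType R) (L : W -> W') (f : V -> W)
    (x v : V) (d : W) :
    (forall a b, L (a - b) = L a - L b) -> (forall k a, L (k *: a) = k *: L a) ->
    continuous L ->
  is_derive x v f d -> is_derive x v (L \o f) (L d).
Proof.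
move=> LB LZ Lc [fd <-].
have H : (fun h => h^-1 *: ((L \o f) (h *: v + x) - (L \o f) x)) @ 0^' -->
    L ('D_v f x).
  under eq_fun do rewrite /= -LB -LZ.
  by apply: continuous_cvg; [exact: Lc|exact: fd].
apply: DeriveDef; first by apply/cvg_ex; exists (L ('D_v f x)).
exact: cvg_lim H.
Qed.

(** This reduces derivatives along the axes of the plane to derivatives of
    functions of one real variable, to which the chain rule and the mean value
    theorem apply. *)
Lemma is_derive_line (V W : normedModType R) (f : V -> W) (x v : V) (d : W)
    (t : R) :
  is_derive t 1 (fun s => f (x + s *: v)) d <-> is_derive (x + t *: v) v f d.
Proof.
have E : (fun h => h^-1 *: (((fun s => f (x + s *: v)) \o shift t) (h *: 1) -
    f (x + t *: v)))
    = (fun h : R => h^-1 *: ((f \o shift (x + t *: v)) (h *: v) - f (x + t *: v))).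
  apply/funext => h /=; congr (_ *: (f _ - _)).
  by rewrite [h *: 1]mulr1 scalerDl addrCA.
by split=> -[c l]; apply: DeriveDef; move: c l; rewrite /derivable /derive ?E.
Qed.
End DirectionalDerivative.

(** * Real coordinates of the plane *)

Section Coordinates.
Variable R : realType.
Local Notation C := (Rcomplex R).

Definition coordinate (b : bool) (z : C) : R := if b then complex.Im z else complex.Re z.

Lemma coordinateD b z w : coordinate b (z + w) = coordinate b z + coordinate b w.
Proof. by case: b z w => -[? ?] [? ?]. Qed.

Lemma coordinateB b z w : coordinate b (z - w) = coordinate b z - coordinate b w.
Proof. by case: b z w => -[? ?] [? ?]. Qed.

Lemma coordinateZ b k z : coordinate b (k *: z) = k * coordinate b z.
Proof. by case: b z => -[? ?]. Qed.

Lemma coordinate_axis b b' : coordinate b (axis R b') = (b == b')%:R.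
Proof. by case: b b' => -[]. Qed.

Lemma coordinate_le b z : `|coordinate b z| <= `|z|.
Proof.
have le_sqrt (x y : R) : `|x| <= Num.sqrt (x ^+ 2 + y ^+ 2).
  by rewrite -sqrtr_sqr ler_wsqrtr// lerDl sqr_ge0.
have -> : `|z| = Num.sqrt (complex.Re z ^+ 2 + complex.Im z ^+ 2) by case: z.
by case: b; [rewrite addrC|]; exact: le_sqrt.
Qed.

Lemma coordinate_continuous b : continuous (coordinate b).
Proof.
move=> z; apply/(@cvgrPdist_le R R C (nbhs z) (nbhs_filter z)) => e e0.
have [/(_ cvg_id e e0) + _] := @cvgrPdist_le R C C (nbhs z) (nbhs_filter z) id z.
apply: (@filterS C (nbhs z) (nbhs_filter z)) => w; apply: le_trans.
by rewrite -coordinateB coordinate_le.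
Qed.

Lemma coordinate_inj z w : (forall b, coordinate b z = coordinate b w) -> z = w.
Proof. by case: z w => [? ?] [? ?] H; have /= -> := H true; have /= -> := H false. Qed.

Definition real_embedding (r : R) : C := r *: 1.

Lemma coordinate_real_embedding b r :
  coordinate b (real_embedding r) = (~~ b)%:R * r.
Proof. by rewrite coordinateZ (coordinate_axis b false) mulrC; case: b. Qed.

Lemma norm_real_embedding r : `|real_embedding r| = `|r|.
Proof. by rewrite normrZ [X in _ * X](Normc.normc1 R) mulr1. Qed.

Lemma is_derive_real_embedding (V : normedModType R) (f : V -> R) x v d :
  is_derive x v f d -> is_derive x v (real_embedding \o f) (real_embedding d).
Proof.
apply: is_derive_linear => [a b|k a|].
- by rewrite /real_embedding scalerBl.
- by rewrite /real_embedding scalerA.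
- exact: scalel_continuous.
Qed.

Lemma is_derive_coordinate_line (f : C -> C) b b' z t :
    derivable f (z + t *: axis R b) (axis R b) ->
  is_derive t 1 (fun s => coordinate b' (f (z + s *: axis R b)))
    (coordinate b' (partial b f (z + t *: axis R b))).
Proof.
move=> /derivableP /is_derive_line.
apply: is_derive_linear; [exact: coordinateB|exact: coordinateZ|].
exact: coordinate_continuous.
Qed.

End Coordinates.

(** * Trigonometric polynomials with variable phases *)

Section TrigonometricPolynomials.
Variable R : realType.
Local Notation C := (Rcomplex R).
Local Notation I := (bool * bool)%type.
Local Notation phase := {ptws I -> R}.

Lemma cos_lipschitz (x y : R) : `|cos x - cos y| <= `|x - y|.
Proof.
wlog xy : x y / y <= x.
  by move=> H; have [/H//|/ltW/H] := leP y x; rewrite distrC [leRHS]distrC.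
have cosc : {within `[y, x], continuous (@cos R)}.
  by apply: continuous_subspaceT; exact: continuous_cos.
have [t _ ->] := @MVT_segment R cos _ y x xy (fun t _ => is_derive_cos t) cosc.
by rewrite normrM normrN ler_piMl// sin_max.
Qed.

(** A function on the torus of angles [theta]; the index [(b, k)] refers to the
    axis [b] and to the [k]-th frequency along that axis. *)
Definition trigpoly (c : R) (A : I -> R) (theta : I -> R) : R :=
  c + \sum_(i : I) A i * cos (theta i).

Lemma trigpoly_lipschitz c A theta eta (d : R) :
    (forall i, `|theta i - eta i| <= d) ->
  `|trigpoly c A theta - trigpoly c A eta| <= (\sum_i `|A i|) * d.
Proof.
move=> td; rewrite /trigpoly opprD addrACA subrr add0r -sumrB mulr_suml.
apply: (le_trans (ler_norm_sum _ _ _)); apply: ler_sum => i _.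
rewrite -mulrBr normrM ler_wpM2l//.
exact: le_trans (cos_lipschitz _ _) (td i).
Qed.

Definition frequency (k : bool) : R := if k then Num.sqrt 2 else 1.

(** The linear winding of the plane in the torus; it has dense image because
    the two frequencies along each axis are incommensurable. *)
Definition flow (z : C) : phase := fun i => frequency i.2 * coordinate i.1 z.

Definition wave c A (phi : phase) : C -> C :=
  fun z => real_embedding (trigpoly c A (fun i => flow z i + phi i)).

Definition partial_amplitude b (A : I -> R) : I -> R :=
  fun i => A i * (frequency i.2 * (i.1 == b)%:R).

Lemma flowD z w i : flow (z + w) i = flow z i + flow w i.
Proof. by rewrite /flow coordinateD mulrDr. Qed.

(** The derivative is written as a phase shift by [pi / 2] rather than with a
    sine, so that waves are stable under partial derivatives. *)
Lemma is_derive_cos_affine (A k a t : R) :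
  is_derive t 1 (fun s => A * cos (s * k + a))
    (A * k * cos (t * k + a + pi / 2)).
Proof.
have aff : is_derive t 1 (fun s : R => s * k + a) k.
  have -> : (fun s : R => s * k + a) = k *: id + cst a.
    by apply/funext => s; rewrite /GRing.add/= mulrC.
  by apply: is_derive_eq; rewrite addr0 [LHS]mulr1.
have /(is_deriveZ A) :=
  @is_derive1_comp R cos _ t _ _ (is_derive_cos (t * k + a)) aff.
move=> dcos; apply: (is_derive_eq dcos).
by rewrite cosDpihalf /GRing.scale/=; ring.
Qed.

Lemma is_derive_wave c A phi b z :
  is_derive z (axis R b) (wave c A phi)
    (wave 0 (partial_amplitude b A) (fun i => phi i + pi / 2) z).
Proof.
apply: is_derive_real_embedding.
(* The line through [z] is parametrized from its origin [z + 0 *: axis R b]. *)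
rewrite -[z in is_derive z]addr0 -[X in z + X](scale0r (axis R b)).
apply/is_derive_line; rewrite /trigpoly add0r -[X in is_derive _ _ _ X]add0r.
apply: (@is_deriveD _ _ _ (cst c)).
elim: (index_enum I) => [|i r IHr].
  by rewrite big_nil; under eq_fun do rewrite big_nil; exact: is_derive_cst.
rewrite big_cons; under eq_fun do rewrite big_cons.
apply: (is_deriveD _ IHr).
have := is_derive_cos_affine (A i) (frequency i.2 * (i.1 == b)%:R)
  (flow z i + phi i) 0.
rewrite mul0r add0r -addrA; congr is_derive; apply/funext => s.
by rewrite flowD /flow coordinateZ coordinate_axis; congr (_ * cos _); ring.
Qed.

Lemma partial_wave b c A phi : partial b (wave c A phi) =
  wave 0 (partial_amplitude b A) (fun i => phi i + pi / 2).
Proof. by apply/funext => z; have [] := is_derive_wave c A phi b z. Qed.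

(** The new amplitudes and the phase shift do not depend on [phi]: this is what
    makes [phi |-> wave c A phi] continuous for all derivatives at once. *)
Lemma partials_wave s c A : exists c' A' (k : R),
  forall phi, partials s (wave c A phi) = wave c' A' (fun i => phi i + k).
Proof.
elim: s => [|b s [c' [A' [k IHs]]]].
  exists c, A, 0 => phi /=; congr wave; apply/funext => i.
  by rewrite addr0.
exists 0, (partial_amplitude b A'), (k + pi / 2) => phi /=.
by rewrite IHs partial_wave; congr wave; apply/funext => i; rewrite addrA.
Qed.

Lemma frequency_ge0 k : 0 <= frequency k.
Proof. by case: k; rewrite /frequency ?sqrtr_ge0. Qed.

Lemma flow_lipschitz z w i : `|flow z i - flow w i| <= Num.sqrt 2 * `|z - w|.
Proof.
rewrite -mulrBr -coordinateB normrM ler_pM ?coordinate_le//.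
rewrite ger0_norm ?frequency_ge0//; case: i.2 => //.
by rewrite -[leLHS]sqrtr1 ler_wsqrtr// ler1n.
Qed.

Lemma wave_continuous c A phi : continuous (wave c A phi).
Proof.
move=> z; apply/(@cvgrPdist_le R C C (nbhs z) (nbhs_filter z)) => e e0.
pose M := (\sum_i `|A i|) * Num.sqrt 2 + 1.
have M0 : 0 < M.
  by rewrite ltr_wpDl// mulr_ge0 ?sqrtr_ge0// sumr_ge0.
have [/(_ cvg_id (e / M) (divr_gt0 e0 M0)) + _] :=
  @cvgrPdist_le R C C (nbhs z) (nbhs_filter z) id z.
apply: (@filterS C (nbhs z) (nbhs_filter z)) => w; rewrite ler_pdivlMr// => zw.
rewrite -scalerBl norm_real_embedding; apply: le_trans zw.
have zwi i : `|flow z i + phi i - (flow w i + phi i)| <= Num.sqrt 2 * `|z - w|.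
  by rewrite opprD addrACA subrr addr0 flow_lipschitz.
apply: (le_trans (trigpoly_lipschitz _ _ zwi)).
by rewrite mulrA mulrC ler_wpM2l// lerDl.
Qed.

Lemma wave_smooth c A phi : smooth (wave c A phi).
Proof.
move=> s; have [c' [A' [k ->]]] := partials_wave s c A.
split=> [|b z]; first exact: wave_continuous.
by have [] := is_derive_wave c' A' (fun i => phi i + k) b z.
Qed.

Definition smooth_wave c A phi : Cinfty R :=
  exist _ (wave c A phi) (mem_set (wave_smooth c A phi)).

(** Uniformity in [theta] gives uniform convergence on the whole plane when the
    phases converge, hence on compact sets. *)
Lemma trigpoly_equicontinuous c A (phi : phase) (e : R) : 0 < e ->
  \forall psi \near phi, forall theta : I -> R,
    `|trigpoly c A (fun i => theta i + phi i)
      - trigpoly c A (fun i => theta i + psi i)| < e.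
Proof.
move=> e0; pose M := \sum_i `|A i| + 1.
have M0 : 0 < M by rewrite ltr_wpDl// sumr_ge0.
have : \forall psi \near phi, forall i, `|phi i - psi i| <= e / M / 2.
  apply: (@filter_forall _ I _ (nbhs phi) (nbhs_filter phi)) => i.
  apply: (@cvgr_dist_le R R phase (nbhs phi) (nbhs_filter phi)
    (fun psi => psi i)).
    exact: (@proj_continuous I (fun=> R) i phi).
  by rewrite !divr_gt0.
apply: (@filterS _ (nbhs phi) (nbhs_filter phi)) => psi close theta.
have close' i : `|theta i + phi i - (theta i + psi i)| <= e / M / 2.
  by rewrite opprD addrACA subrr add0r.
apply: (le_lt_trans (trigpoly_lipschitz _ _ close')).
have eM0 : 0 <= e / M / 2 by rewrite !divr_ge0 ?ltW.
have /(ler_wpM2r eM0) : \sum_i `|A i| <= M by rewrite lerDl.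
move/le_lt_trans; apply; rewrite mulrA mulrCA mulfV ?gt_eqF// mulr1.
by rewrite ltr_pdivrMr// ltr_pMr// ltr1n.
Qed.

Lemma smooth_wave_continuous c A : continuous (smooth_wave c A).
Proof.
apply: (@continuous_comp_initial (Cinfty R) phase
  {ptws seq bool -> {family compact, C -> C}} (@jet R) (smooth_wave c A)).
apply: continuous_into_ptws => s phi.
pose F : phase -> {family compact, C -> C} :=
  fun psi => jet (smooth_wave c A psi) s.
apply/(@fam_cvgP C C compact (F @ phi) (F phi) (fmap_filter _ (nbhs_filter phi))).
move=> K _ P /(@uniform_nbhs C K C)[E [/= entE EP]].
have [c' [A' [k pw]]] := partials_wave s c A.
have [e /= e0 eE] : exists2 e : R, 0 < e & [set xy | ball xy.1 e xy.2] `<=` E.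
  by move: entE; rewrite -entourage_ballE.
have := trigpoly_equicontinuous c' A' phi e0.
apply: (@filterS _ (nbhs phi) (nbhs_filter phi)) => psi close.
apply: EP => z _; apply: eE => /=.
rewrite -[F phi z]/(partials s (wave c A phi) z).
rewrite -[F psi z]/(partials s (wave c A psi) z) !pw -ball_normE /=.
rewrite -scalerBl norm_real_embedding.
have -> : (fun i => flow z i + (phi i + k)) = (fun i => (flow z i + k) + phi i).
  by apply/funext => i; rewrite addrA addrAC.
have -> : (fun i => flow z i + (psi i + k)) = (fun i => (flow z i + k) + psi i).
  by apply/funext => i; rewrite addrA addrAC.
exact: close (fun i => flow z i + k).
Qed.
End TrigonometricPolynomials.

(** * Waves have trivial stabilizer *)

Section Freeness.
Variable R : realType.
Local Notation C := (Rcomplex R).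
Local Notation I := (bool * bool)%type.
Local Notation phase := {ptws I -> R}.

Lemma cosD2piz (x : R) (m : int) : cos (x + pi *+ 2 * m%:~R) = cos x.
Proof.
have cosDn (y : R) n : cos (y + pi *+ 2 * n%:R) = cos y.
  by rewrite mulr_natr (periodicn (@cosD2pi R)).
case: m => n; first exact: cosDn.
by rewrite -(cosDn _ n.+1) NegzE mulrNz mulrN addrNK.
Qed.

Definition mod2pi (x : R) : R := x - pi *+ 2 * (Num.floor (x / (pi *+ 2)))%:~R.

Lemma cos_mod2pi (x y : R) : cos (x + mod2pi y) = cos (x + y).
Proof. by rewrite /mod2pi addrA -mulrN -mulrNz cosD2piz. Qed.

Lemma mod2pi_itv x : 0 <= mod2pi x < pi *+ 2.
Proof.
have pi20 : 0 < (pi : R) *+ 2 by rewrite pmulrn_lgt0// pi_gt0.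
have /andP[fl fu] := floor_itv (x / (pi *+ 2)).
rewrite /mod2pi subr_ge0 ltrBlDr; apply/andP; split.
  by rewrite mulrC -ler_pdivlMr.
by rewrite -[X in X + _]mulr1 -mulrDr mulrC -ltr_pdivrMr// addrC -intrD1.
Qed.

Lemma cos_eq1 (x : R) : cos x = 1 -> exists m : int, x = pi *+ 2 * m%:~R.
Proof.
move=> cx1; exists (Num.floor (x / (pi *+ 2))); apply/eqP; rewrite -subr_eq0.
have /andP[r0 r2] := mod2pi_itv x.
have : cos (mod2pi x) = cos 0.
  by rewrite -[mod2pi x]add0r cos_mod2pi add0r cx1 cos0.
rewrite -/(mod2pi x); case: (leP (mod2pi x) pi) => rpi.
  by move/cos_inj => ->//; rewrite in_itv/= ?r0// lexx pi_ge0.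
(* Otherwise [2 pi - mod2pi x] lies in [[0, pi]], where [cos] is injective. *)
rewrite -cosN -(cosD2pi (- _)) => /cos_inj -/(_ _ _)/eqP.
rewrite addrC subr_eq0 eq_sym => eq2pi.
have : mod2pi x == pi *+ 2.
  apply: eq2pi; rewrite in_itv/= ?lexx ?pi_ge0//.
  by rewrite subr_ge0 (ltW r2)/= lerBlDr mulr2n lerD2l ltW.
by move=> /eqP E; rewrite E ltxx in r2.
Qed.

(** Compare the parities of the exponent of [2] in [2 m ^ 2] and [n ^ 2]. *)
Lemma sqrt2_irrational (m n : int) :
  Num.sqrt 2 * m%:~R = n%:~R :> R -> m = 0.
Proof.
move=> /(congr1 (fun x => x ^+ 2)); rewrite exprMn sqr_sqrtr ?ler0n// => E.
have {}E : 2 * m ^+ 2 = n ^+ 2.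
  by apply: (@intr_inj R); rewrite rmorphM !rmorphXn.
have {}E : (2 * `|m| ^ 2 = `|n| ^ 2)%N.
  by rewrite -!abszX -E abszM.
apply/eqP; rewrite -absz_eq0; apply/negPn/negP; rewrite -lt0n => m0.
have n0 : (0 < `|n|)%N by rewrite -sqrn_gt0 -E muln_gt0 sqrn_gt0.
have /(congr1 odd) := congr1 (logn 2) E.
by rewrite lognM ?expn_gt0 ?m0// !lognX oddD !oddM.
Qed.

Lemma sum_pair_bool (F : I -> R) : \sum_i F i =
  F (true, true) + F (true, false) + (F (false, true) + F (false, false)).
Proof.
by rewrite -(eq_bigr _ (fun i _ => congr1 F (esym (surjective_pairing i))))
  -(pair_bigA _ (fun a b => F (a, b)))/= !big_bool.
Qed.

(** The two frequencies along the axis [b] are separated by derivatives: on a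
    cosine of frequency [q] the second derivative acts as [- q ^ 2], and the
    squared frequencies [1] and [2] differ.  So each cosine is a combination of
    the second and the fourth derivative and inherits the period [w]. *)
Lemma wave_period_cos c A (phi : phase) w i : A i != 0 ->
    (forall z, wave c A phi (z + w) = wave c A phi z) ->
  cos (flow w i) = 1.
Proof.
case: i => b k Abk inv.
pose u k z := A (b, k) * cos (flow z (b, k) + phi (b, k)).
have inv_partials s z :
    partials s (wave c A phi) (z + w) = partials s (wave c A phi) z.
  rewrite -[RHS](congr1 (fun f => partials s f z) (funext inv)).
  by rewrite partials_comp_shift.
have cosDpi2 (x : R) : cos (x + pi / 2 + pi / 2) = - cos x.
  by rewrite cosDpihalf sinDpihalf.
have f2 : frequency R true * frequency R true = 2.
  by rewrite -expr2 sqr_sqrtr.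
have p2 z : coordinate false (partials [:: b; b] (wave c A phi) z) =
    - (u false z + 2 * u true z).
  rewrite [partials _ _]/= !partial_wave coordinate_real_embedding mul1r /trigpoly add0r.
  rewrite sum_pair_bool /partial_amplitude /= !addrA !cosDpi2.
  rewrite -[2 * _](congr1 (fun x => x * u true z) f2) /u.
  by case: (b); rewrite /= /frequency; ring.
have p4 z : coordinate false (partials [:: b; b; b; b] (wave c A phi) z) =
    u false z + 4 * u true z.
  rewrite [partials _ _]/= !partial_wave coordinate_real_embedding mul1r /trigpoly add0r.
  rewrite sum_pair_bool /partial_amplitude /= !addrA !cosDpi2.
  have -> : 4 * u true z = frequency R true * frequency R true *
      (frequency R true * frequency R true) * u true z by rewrite f2; ring.
  by rewrite /u; case: (b); rewrite /= /frequency; ring.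
have uw z : u k (z + w) = u k z.
  have := p2 (z + w); have := p4 (z + w).
  rewrite !inv_partials p2 p4 => E4 E2.
  by case: (k); lra.
have f0 : frequency R k != 0.
  by case: (k); rewrite /frequency ?sqrtr_eq0 ?oner_eq0// -ltNge.
(* At this point the angle [flow z (b, k) + phi (b, k)] vanishes. *)
have := uw ((- phi (b, k) / frequency R k) *: axis R b).
rewrite /u => /(mulfI Abk); rewrite flowD.
have -> : flow ((- phi (b, k) / frequency R k) *: axis R b) (b, k) =
    - phi (b, k).
  by rewrite /flow coordinateZ coordinate_axis/= eqxx mulr1 mulrC divfK.
by rewrite addrAC addNr add0r cos0.
Qed.

Lemma smooth_wave_Free c A (phi : phase) :
  (forall i, A i != 0) -> Free R (smooth_wave c A phi).
Proof.
move=> A0; apply/seteqP; split=> [w /(congr1 val)/= fixw|w ->].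
  have inv z : wave c A phi (z + w) = wave c A phi z by exact: (congr1 (@^~ z) fixw).
  apply: coordinate_inj => b.
  have [m] := cos_eq1 (wave_period_cos (A0 (b, false)) inv).
  have [n] := cos_eq1 (wave_period_cos (A0 (b, true)) inv).
  rewrite /flow /frequency mul1r => En Em; move: En; rewrite Em mulrCA.
  have pi20 : (pi : R) *+ 2 != 0 by rewrite mulrn_eq0/= gt_eqF// pi_gt0.
  move=> /(mulfI pi20)/sqrt2_irrational ->.
  by rewrite mulr0; case: b {Em}.
by apply/val_inj/funext => z; rewrite /= /Cinfty_fun /= addr0.
Qed.

End Freeness.

(** * Bounded functions do not solve dbar g >= 1 *)

Section BoundedPrimitive.
Variable R : realType.
Local Notation C := (Rcomplex R).

Lemma MVT_everywhere (f df : R -> R) (a b : R) : a <= b ->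
    (forall s, is_derive s (1 : R) f (df s)) ->
  exists2 c, a <= c <= b & f b - f a = df c * (b - a).
Proof.
move=> ab fd; have [|c] := @MVT_segment R f df a b ab (fun s _ => fd s).
  by apply: derivable_within_continuous => s _; have [] := fd s.
by rewrite in_itv/=; exists c.
Qed.

Lemma forward_difference_le (f f1 f2 : R -> R) (M h : R) : 0 <= h ->
    (forall s, is_derive s (1 : R) f (f1 s)) -> (forall s, is_derive s (1 : R) f1 (f2 s)) ->
    (forall s, `|f2 s| <= M) ->
  f h - f 0 <= h * f1 0 + M * h ^+ 2.
Proof.
move=> h0 fd f1d f2M.
have [c /andP[c0 ch]] := MVT_everywhere h0 fd.
rewrite !subr0 => ->; have [c' _] := MVT_everywhere c0 f1d; rewrite subr0 => E.
have : f1 c - f1 0 <= M * h.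
  rewrite E (le_trans (ler_norm _))// normrM ler_pM//.
  by rewrite ger0_norm.
by move=> /(ler_wpM2l h0); lra.
Qed.

Lemma unbounded_of_derive_ge1 (f df : R -> R) (B : R) :
    (forall s, is_derive s (1 : R) f (df s)) -> (forall s, 1 <= df s) ->
  exists s, B < `|f s|.
Proof.
move=> fd df1; have s0 : 0 <= `|f 0| + `|B| + 1 by rewrite !addr_ge0.
have [c _] := MVT_everywhere s0 fd; rewrite subr0 => E.
exists (`|f 0| + `|B| + 1).
have := ler_wpM2r s0 (df1 c); rewrite -E mul1r => le_s.
have := ler_norm (f (`|f 0| + `|B| + 1)).
have := ler_norm B; have := lerNnormlW (lexx `|f 0|); lra.
Qed.

(** Twice the real part of [dbar g] is the divergence of [(Re g, - Im g)]. *)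
Lemma dbar_real_part (g : C -> C) z :
  coordinate false (dbar g z) *+ 2 =
  coordinate false (partial false g z) - coordinate true (partial true g z).
Proof.
have -> : - coordinate true (partial true g z) =
    coordinate false (imagunit R * partial true g z).
  by case: (partial true g z) => x y; rewrite /coordinate /= mul0r mul1r sub0r.
rewrite -coordinateD mulr2n -coordinateD -mulr2n -mulr_natl mulrA.
by rewrite divff ?mul1r.
Qed.

(** Sum [Re g] over the nodes of a column of mesh [h] and move the column
    horizontally.  By the divergence bound the speed of the sum is at least the
    length of the column minus the vertical differences of [Im g]; these telescope
    to at most [2 M], up to an error [M * h ^ 2] at each node.  For a long enough
    column the sum thus grows at least linearly, although it is bounded. *)
Lemma dbar_primitive_unbounded (g : C -> C) (M : R) : smooth g ->
    (forall z, `|g z| <= M) -> (forall z, `|partials [:: true; true] g z| <= M) ->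
  ~ forall z, 1 <= coordinate false (dbar g z).
Proof.
move=> gs gM g2M div1.
have M0 : 0 <= M by exact: le_trans (normr_ge0 _) (gM 0).
(* With [M * h < 1], each node contributes at least [h] to the speed after
   its error [M * h ^ 2] is deducted. *)
pose h := (M + 1)^-1.
have h0 : 0 < h by rewrite invr_gt0; lra.
have hM : h * (M + 1) = 1 by rewrite mulVf//; apply/eqP; lra.
pose node (k : nat) x : C := (k%:R * h) *: axis R true + x *: axis R false.
have column_step k x : coordinate true (g (node k.+1 x)) -
    coordinate true (g (node k x)) <=
    h * coordinate true (partial true g (node k x)) + M * h ^+ 2.
  have := @forward_difference_le
    (fun s => coordinate true (g (node k x + s *: axis R true)))
    (fun s => coordinate true (partial true g (node k x + s *: axis R true)))
    (fun s => coordinate true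
      (partials [:: true; true] g (node k x + s *: axis R true)))
    M h (ltW h0).
  rewrite scale0r addr0.
  have -> : node k x + h *: axis R true = node k.+1 x.
    by rewrite /node addrAC -scalerDl -natr1 mulrDl mul1r.
  apply=> s.
  - by apply: is_derive_coordinate_line; have [_] := gs [::]; apply.
  - by apply: is_derive_coordinate_line; have [_] := gs [:: true]; apply.
  - exact: le_trans (coordinate_le _ _) (g2M _).
(* The column has length [n * h >= 2 * M + 1], one more than the boundary term. *)
pose n := Num.bound ((2 * M + 1) * (M + 1)).
have nE : (2 * M + 1) * (M + 1) <= n%:R.
  by rewrite ltW// archi_boundP// mulr_ge0; lra.
pose S x := \sum_(0 <= k < n) coordinate false (g (node k x)).
pose S' x := \sum_(0 <= k < n) coordinate false (partial false g (node k x)).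
have S_derive x : is_derive x (1 : R) S (S' x).
  rewrite /S /S'; elim: (index_iota 0 n) => [|k r IHr].
    by rewrite big_nil; under eq_fun do rewrite big_nil; exact: is_derive_cst.
  rewrite big_cons; under eq_fun do rewrite big_cons.
  apply: (is_deriveD _ IHr).
  by apply: is_derive_coordinate_line; have [_] := gs [::]; apply.
have S'_ge1 x : 1 <= S' x.
  have : h * S' x >= \sum_(0 <= k < n) (h + (coordinate true (g (node k.+1 x)) -
      coordinate true (g (node k x)))).
    rewrite mulr_sumr; apply: ler_sum => k _.
    have := dbar_real_part g (node k x); have := div1 (node k x).
    move=> d1 d2; have := column_step k x; have := hM; nra.
  rewrite big_split/= telescope_sumr// sumr_const_nat subn0.
  have := coordinate_le true (g (node n x)); have := gM (node n x).
  have := coordinate_le true (g (node 0 x)); have := gM (node 0 x).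
  rewrite !ler_norml => g0 /andP[_ c0] gn /andP[cn _].
  have nh : 2 * M + 1 <= h *+ n by rewrite -mulr_natr; nra.
  move=> hS; have {hS} : 1 <= h * S' x by lra.
  have h1 : h <= 1 by nra.
  move=> hS; rewrite leNgt; apply/negP; rewrite -(ltr_pM2l h0) mulr1 => hS1.
  by lra.
have [x] := unbounded_of_derive_ge1 (n%:R * M) S_derive S'_ge1.
apply/negP; rewrite -leNgt (le_trans (ler_norm_sum _ _ _))//.
rewrite mulr_natl -[n in leRHS]subn0 -sumr_const_nat; apply: ler_sum => k _.
exact: le_trans (coordinate_le _ _) (gM _).
Qed.
End BoundedPrimitive.

(** * The compact orbit closure and its image *)

Section BoundedOrbit.
Variable R : realType.
Local Notation C := (Rcomplex R).
Local Notation I := (bool * bool)%type.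
Local Notation phase := {ptws I -> R}.

Lemma partials_eval_continuous s (z : C) :
  continuous (fun f : Cinfty R => partials s f z).
Proof.
move=> f.
have jc : jet g @[g --> f] --> jet f := @initial_continuous _ _ (@jet R) f.
have pc := @proj_continuous (seq bool) (fun=> {family compact, C -> C}) s (jet f).
have sc : (jet g s : {family compact, C -> C}) @[g --> f] --> jet f s.
  exact: (cvg_comp _ _ jc pc).
pose F : set_system {family compact, C -> C} := (jet g s)@[g --> f].
have FF : Filter F := fmap_filter _ (nbhs_filter f).
have /(@pointwise_cvgP C C F (jet f s) FF) := pointwise_cvg_compact_family FF sc.
exact.
Qed.

(** By equivariance the values of a partial derivative of [xi f] on the plane are
    its values at the single point [0] along the orbit of [f]. *)
Lemma bounded_partials_of_compact_orbit (xi : Free R -> Cinfty R)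
    (K : set (Free R)) (f : Free R) (s : seq bool) :
    continuous xi ->
    (forall w (g : Free R), xi (translate_free w g) = translate w (xi g)) ->
    compact K -> (forall w, K (translate_free w f)) ->
  exists M, forall z, `|partials s (xi f) z| <= M.
Proof.
move=> xic xieq Kc Kf.
have ec : continuous (fun g : Free R => partials s (xi g) 0).
  move=> g.
  exact: (cvg_comp _ _ (xic g) (@partials_eval_continuous s 0 (xi g))).
have /compact_bounded[M [_ /(_ (M + 1)) HM]] :=
  continuous_compact (continuous_subspaceT ec) Kc.
exists (M + 1) => z.
have -> : partials s (xi f) z = partials s (xi (translate_free z f)) 0.
  rewrite xieq -[partials s _ 0]/(partials s (fun y => xi f (y + z)) 0).
  by rewrite partials_comp_shift add0r.
by apply: HM; [rewrite ltrDl|exists (translate_free z f)].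
Qed.

(** The constant [5] exceeds by one the largest value that the four cosines can
    subtract. *)
Definition free_wave (phi : phase) : Free R :=
  exist (fun f => f \in Free R) (smooth_wave 5 (fun=> 1) phi)
    (mem_set (smooth_wave_Free 5 phi (fun=> oner_neq0 R))).

Lemma free_wave_continuous : continuous free_wave.
Proof.
apply: (@continuous_comp_initial (Free R) phase (Cinfty R) set_val free_wave).
exact: smooth_wave_continuous.
Qed.

Definition phase_box : set phase :=
  [set phi | forall i, `[0, pi *+ 2]%classic (phi i)].

Lemma phase_box_compact : compact phase_box.
Proof.
apply: (@tychonoff I (fun=> R) (fun=> `[0, pi *+ 2]%classic)) => i.
exact: segment_compact.
Qed.

(** Reducing the phases modulo [2 pi] keeps the whole orbit inside the image of
    the compact box of phases. *)
Lemma translate_free_wave w phi :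
  translate_free w (free_wave phi) =
  free_wave (fun i => mod2pi (flow w i + phi i)).
Proof.
apply/val_inj/val_inj/funext => z /=; rewrite /Cinfty_fun /=; congr real_embedding.
congr (_ + _); apply: eq_bigr => i _.
by rewrite cos_mod2pi flowD addrA.
Qed.

Lemma trigpoly_ge1 (theta : I -> R) : 1 <= trigpoly 5 (fun=> 1) theta.
Proof.
rewrite /trigpoly sum_pair_bool !mul1r.
have := cos_geN1 (theta (true, true)); have := cos_geN1 (theta (true, false)).
have := cos_geN1 (theta (false, true)); have := cos_geN1 (theta (false, false)).
lra.
Qed.

End BoundedOrbit.

Theorem theorem6p6 (R : realType) :
  ~ exists xi : Free R -> Cinfty R,
      [/\ continuous xi,
          forall (w : Rcomplex R) (f : Free R),
            xi (translate_free w f) = translate w (xi f) &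
          forall f : Free R, dbar (xi f) =1 Cinfty_fun (\val f)].
Proof.
move=> [xi [xic xieq xidbar]].
pose phi0 : {ptws bool * bool -> R} := fun=> 0.
have Kc : compact (@free_wave R @` @phase_box R).
  apply: continuous_compact (@phase_box_compact R).
  by apply: continuous_subspaceT; exact: free_wave_continuous.
have Kf w : (@free_wave R @` @phase_box R) (translate_free w (free_wave phi0)).
  rewrite translate_free_wave; eexists; last reflexivity.
  move=> i /=; rewrite in_itv/=.
  by case/andP: (mod2pi_itv (flow w i + phi0 i)) => -> /ltW.
have [M0 HM0] := bounded_partials_of_compact_orbit [::] xic xieq Kc Kf.
have [M2 HM2] :=
  bounded_partials_of_compact_orbit [:: true; true] xic xieq Kc Kf.
apply: (@dbar_primitive_unbounded R (xi (free_wave phi0)) (Num.max M0 M2)).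
- exact: (set_valP (xi (free_wave phi0))).
- by move=> z; rewrite le_max HM0.
- by move=> z; rewrite le_max HM2 orbT.
move=> z; rewrite xidbar.
rewrite -[Cinfty_fun _ _]/(wave 5 (fun=> 1) phi0 z) coordinate_real_embedding mul1r.
exact: trigpoly_ge1.
Qed.
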